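(* Consider the problem $$\max\ f_0(x)\quad\text{s.t.}\quad x_i\le f_i(x)\ \ \forall i\in\mathbb A,\qquad x_i=f_i(x)\ \ \forall i\in\mathbb B,\qquad x\in\mathcal X, \qquad (P_{\mathcal X})$$ with data as in the context and $\mathcal X\subseteq\mathbb R^n$ an arbitrary set. If the General Qualifying Condition holds (for every $x\in\mathcal D$), and $\mathcal X$ contains a point $x^\star\in\mathcal D$ with $x^\star=f(x^\star)$, then problem $(P_{\mathcal X})$ is Fast-Lipschitz.
   Context: Problem data: $f_0:\mathbb R^n\to\mathbb R^m$ ($m\ge1$) is differentiable; $f_i:\mathbb R^n\to\mathbb R$ ($i=1,\dots,n$) are differentiable and $f(x)=(f_1(x),\dots,f_n(x))^T$; $\mathbb A,\mathbb B$ are complementary subsets of $\{1,\dots,n\}$. Let $(P)$ denote the problem obtained from $(P_{\mathcal X})$ by deleting the constraint $x\in\mathcal X$. Notation: all inequalities between vectors or matrices are element-wise. $[\nabla f(x)]_{ij}=\partial f_j(x)/\partial x_i$ (transposed Jacobian), similarly $\nabla f_0(x)\in\mathbb R^{n\times m}$. $\nabla f(x)^k$ is the $k$-th matrix power. $\|A\|_\infty=\max_i\sum_j|A_{ij}|$. Pareto optimality: maximization is with respect to the non-negative orthant of $\mathbb R^m$; a feasible $\hat x$ is Pareto optimal if there is no other feasible $x$ with $f_0(x)\ge f_0(\hat x)$. Bounding box: $\mathcal D=\{x\in\mathbb R^n: a\le x\le b\}$ with $a,b\in\mathbb R^n$. Standing assumptions: $f(\mathcal D)\subseteq\mathcal D$,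 and $\mathcal D$ contains all candidates for optimality of $(P)$, i.e., for every $\mu\in\mathbb R^m$ with $\mu>0$ the maximum of $\mu^Tf_0(x)$ over the feasible set of $(P)$ is attained and every maximizer lies in $\mathcal D$. Fast-Lipschitz: the problem is Fast-Lipschitz if it admits a unique Pareto optimal solution $x^\star$, which is the unique solution (in $\mathcal D$) of $x=f(x)$. General Qualifying Condition (at $x$): let $q(x)=\min_j \frac{\min_i[\nabla f_0(x)]_{ij}}{\max_i[\nabla f_0(x)]_{ij}}$. (a) $\nabla f_0(x)\ge 0$ and every row of $\nabla f_0(x)$ is non-zero; (b) $\|\nabla f(x)\|<1$, where $\|\cdot\|$ is some (sub-multiplicative) matrix norm, the same for all $x\in\mathcal D$; and there exists $k\in\{1,2,\dots\}\cup\{\infty\}$ such that (c) if $k<\infty$, then $\nabla f(x)^k\ge0$; (d) if $k>1$, then $\left\|\sum_{l=1}^{k-1}\nabla f(x)^l\right\|_\infty<q(x)$. *)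

(* Defs.v *)
(* World: MathComp / MathComp-Analysis. *)
From HB Require Import structures.
From mathcomp Require Export all_boot all_order all_algebra.
From mathcomp Require Export all_classical all_reals all_analysis.
Export Order.TTheory GRing.Theory Num.Theory.
Export numFieldNormedType.Exports.

Set Implicit Arguments.
Unset Strict Implicit.
Unset Printing Implicit Defensive.

Global Open Scope classical_set_scope.
Global Open Scope ring_scope.

(* Points of R^n are row vectors.  With this convention the library Jacobian
   'J g x of a differentiable g satisfies 'D_v g x = v *m 'J g x, so its entry
   (i, j) is the partial derivative of g_j with respect to x_i, as in nabla g. *)

Section matrices.
Context {R : realType}.

Definition lemx {p q} (M P : 'M[R]_(p, q)) : Prop := forall i j, M i j <= P i j.
Definition ltmx {p q} (M P : 'M[R]_(p, q)) : Prop := forall i j, M i j < P i j.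

Definition norm_infty {p q} (M : 'M[R]_(p, q)) : R :=
  \big[Num.max/0]_(i < p) \sum_(j < q) `|M i j|.

Definition submultiplicative_norm {n} (N : 'M[R]_n -> R) : Prop :=
  [/\ forall M, 0 <= N M,
      forall M, N M = 0 -> M = 0,
      forall c M, N (c *: M) = `|c| * N M,
      forall M P, N (M + P) <= N M + N P
    & forall M P, N (M *m P) <= N M * N P].

Definition col_min {n m} (G : 'M[R]_(n.+1, m)) (j : 'I_m) : R :=
  \big[Num.min/G ord0 j]_(i < n.+1) G i j.
Definition col_max {n m} (G : 'M[R]_(n.+1, m)) (j : 'I_m) : R :=
  \big[Num.max/G ord0 j]_(i < n.+1) G i j.

(* If the nonnegative matrix G has a zero column, the quotient 0 / 0 for that
   column is 0 here, hence q_ratio G = 0 and no norm is < q_ratio G. *)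
Definition q_ratio {n m} (G : 'M[R]_(n.+1, m.+1)) : R :=
  \big[Num.min/col_min G ord0 / col_max G ord0]_(j < m.+1)
    (col_min G j / col_max G j).

End matrices.

Section problem.
Context {R : realType} {n m : nat}.
Implicit Types (fobj : 'rV[R]_n.+1 -> 'rV[R]_m.+1)
  (f : 'rV[R]_n.+1 -> 'rV[R]_n.+1).
Implicit Types (F D : set 'rV[R]_n.+1) (x : 'rV[R]_n.+1).

Definition box (a b : 'rV[R]_n.+1) : set 'rV[R]_n.+1 :=
  [set x | lemx a x /\ lemx x b].

Definition feasible f (A B : {set 'I_n.+1}) : set 'rV[R]_n.+1 :=
  [set x : 'rV[R]_n.+1 | (forall i, i \in A -> x 0 i <= f x 0 i) /\
                          (forall i, i \in B -> x 0 i = f x 0 i)].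

Definition pareto_optimal fobj F x : Prop :=
  F x /\ ~ exists y, [/\ F y, y <> x & lemx (fobj x) (fobj y)].

Definition maximizers (phi : 'rV[R]_n.+1 -> R) F : set 'rV[R]_n.+1 :=
  [set x | F x /\ forall y, F y -> phi y <= phi x].

Definition contains_candidates fobj F D : Prop :=
  forall mu : 'rV[R]_m.+1, ltmx 0 mu ->
    let M := maximizers (fun x => \sum_j mu 0 j * fobj x 0 j) F in
    M !=set0 /\ M `<=` D.

Definition fast_lipschitz fobj f F D : Prop :=
  exists xs, unique (pareto_optimal fobj F) xs /\
             unique (fun x => D x /\ x = f x) xs.

(* None stands for k = infinity; the limit of the partial sums then exists in
   gqc_at, because some submultiplicative norm of 'J f x is < 1. *)
Definition gqc_order fobj f x (k : option nat) : Prop :=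
  match k with
  | Some k =>
      [/\ (0 < k)%N,
          lemx 0 ('J f x ^+ k)
        & (1 < k)%N ->
          norm_infty (\sum_(1 <= l < k) 'J f x ^+ l) < q_ratio ('J fobj x)]
  | None =>
      norm_infty (\big[+%R/0]_(1 <= l <oo) 'J f x ^+ l) < q_ratio ('J fobj x)
  end.

Definition gqc_at (N : 'M[R]_n.+1 -> R) fobj f x : Prop :=
  [/\ lemx 0 ('J fobj x),
      forall i, row i ('J fobj x) != 0,
      N ('J f x) < 1
    & exists k, gqc_order fobj f x k].

Definition general_qualifying_condition fobj f D : Prop :=
  exists2 N, submultiplicative_norm N & forall x, D x -> gqc_at N fobj f x.

End problem.

(* Main.v *)
Require Import Defs.
From mathcomp Require Import ring lra zify.

(** Scalarise the problem without the constraint x in X.  Fix weights mu > 0 and a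
    maximizer x of the weighted sum of the objectives over the feasible set; by
    hypothesis it lies in the box, so the qualifying condition holds at x.  Write
    J for the Jacobian of f at x and c for the gradient of the weighted objective.

    The multipliers lam = (1 - J)^-1 c are positive (multiplier_gt0); this is the
    algebraic content of the qualifying condition.  If some constraint
    x_i <= f_i(x) had slack, a displacement t e_i (1 - J)^-1 would change, to first
    order, only the i-th residual, by t, and the objective by t lam_i > 0.  Hence a
    maximizer has no slack: it is a fixed point of f (maximizer_fixed).

    Turning the first-order displacement into a feasible point requires exact
    solutions of perturbed equations for maps that are differentiable but not C^1,
    and possibly outside the box, where the Jacobians are not controlled.  This is
    done by a degree argument (local_solve), based on the Poincare-Miranda theorem,
    which follows from Kuhn's cubical Sperner lemma.  The latter is proved by
    computing, in F_2, the total over a grid of a cup product of coboundaries: the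
    product is exact, and its boundary terms reduce to a grid of smaller dimension.

    Fixed points in the box are unique because the Jacobians have norm < 1 there
    (fixed_point_unique).  Therefore the given fixed point xs is the unique maximizer
    for every mu > 0.  Letting mu concentrate on one objective shows that xs dominates
    every feasible point; equal weights show that only xs itself dominates xs.  Both
    facts persist on the smaller feasible set cut out by X, because xs lies in X. *)

Set Implicit Arguments.
Unset Strict Implicit.
Unset Printing Implicit Defensive.

(** * Kuhn's cubical lemma *)

Section kuhn.
Variables (Z : comNzRingType) (addrr2 : forall a : Z, a + a = 0).
Variables (T : finType) (K : nat).
Notation pt := (T -> nat).
Implicit Types (x y : pt) (i j l : T) (S : {set T}) (L : seq T) (h : pt -> Z).

Definition step x i : pt := fun j => (x j + (j == i))%N.
Definition upd x i t : pt := fun j => if j == i then t else x j.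
(** The cubical coboundary of a 0-cochain along the edge from x in direction i.
    In characteristic 2 the sum is the difference, and orientations of cells
    disappear. *)
Definition diff i h x : Z := h (step x i) + h x.

Lemma stepC x i j : step (step x i) j = step (step x j) i.
Proof. by apply: funext => l; rewrite /step addnAC. Qed.

(** The pairs (i, j) and (j, i) cancel in characteristic 2; this is what makes
    the coboundary square to zero below. *)
Lemma sum_sym_char2 S (c : T -> T -> Z) : (forall i j, c i j = c j i) ->
  \sum_(i in S) \sum_(j in S :\ i) c i j = 0.
Proof.
move=> cC; pose r i j := (enum_rank i < enum_rank j)%N.
have -> : \sum_(i in S) \sum_(j in S :\ i) c i j
  = \sum_(i in S) \sum_(j in S | r i j) c i j
  + \sum_(i in S) \sum_(j in S | r j i) c i j.
  rewrite -big_split/=; apply: eq_bigr => i iS.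
  rewrite (bigID (r i))/=; congr (_ + _); apply: eq_bigl => j; rewrite !inE.
    rewrite /r; have [->|] /= := eqVneq j i; last by [].
    by rewrite ltnn andbF.
  rewrite /r; have [->|ji] /= := eqVneq j i; first by rewrite ltnn andbF.
  rewrite -leqNgt ltn_neqAle; congr (_ && _); rewrite andbC.
  by case: leq => //=; apply/esym/eqP => /val_inj/enum_rank_inj/eqP; exact/negP.
rewrite [X in _ + X](exchange_big_dep [in S])/=; last by move=> i j _ /andP[].
rewrite -[RHS](addrr2 (\sum_(i in S) \sum_(j in S | r i j) c i j)).
congr (_ + _); apply: eq_bigr => i iS.
by apply: eq_big => [j|j _]; [rewrite iS | exact: cC].
Qed.

Variable g : T -> pt -> Z.

(** The cubical cup product of the 1-cochains diff (g l), for l in L, on the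
    cube with lowest vertex x spanned by the directions in S: expanding the
    recursion gives a sum over the monotone edge paths of the cube, the k-th
    edge of a path being weighted by the k-th cochain of L. *)
Fixpoint cup L S x : Z :=
  if L is l :: L' then
    \sum_(i in S) diff i (g l) x * cup L' (S :\ i) (step x i)
  else 1.

(** A cup product of exact cochains is closed.  After expansion the terms with
    both steps taken are symmetric in the two directions, and the others are
    either again symmetric or the closedness of a shorter product. *)
Lemma cup_closed L S x :
  \sum_(i in S) diff i (cup L (S :\ i)) x = 0.
Proof.
elim: L S x => [|l L IH] S x /=.
  by rewrite big1// => i _; rewrite /diff/= addrr2.
have setD1C i j : S :\ i :\ j = S :\ j :\ i by apply/finset.setP => k; rewrite !inE andbCA.
have swap (c : T -> T -> Z) : \sum_(i in S) \sum_(j in S :\ i) c i j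
    = \sum_(i in S) \sum_(j in S :\ i) c j i.
  rewrite (exchange_big_dep [in S])/=; last by move=> i j _; rewrite inE => /andP[].
  apply: eq_bigr => i iS; apply: eq_bigl => j.
  by rewrite !inE iS andbT andbC eq_sym.
pose w i j y := cup L (S :\ i :\ j) y.
have wC i j y : w i j y = w j i y by rewrite /w setD1C.
have IHw i y : i \in S -> \sum_(j in S :\ i) (w i j (step y j) + w i j y) = 0.
  by move=> iS; rewrite -[RHS](IH (S :\ i) y).
transitivity (\sum_(i in S) \sum_(j in S :\ i)
   (g l (step (step x i) j) * w i j (step (step x i) j)
   + (g l (step x i) * (w i j (step (step x i) j) + w i j (step x i))
   + g l x * w i j (step x i)))).
  rewrite /diff /=.
  transitivity (\sum_(i in S) \sum_(j in S :\ i)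
    (g l (step (step x i) j) + g l (step x i)) * w i j (step (step x i) j)
    + \sum_(i in S) \sum_(j in S :\ i) (g l (step x j) + g l x) * w i j (step x j)).
    by rewrite -big_split.
  rewrite [X in _ + X]swap -big_split/=; apply: eq_bigr => i iS.
  rewrite -big_split/=; apply: eq_bigr => j jS; rewrite (wC j i).
  by rewrite !mulrDl mulrDr !addrA.
under eq_bigr do rewrite !big_split/= -!mulr_sumr.
rewrite !big_split/= sum_sym_char2 ?add0r; last by move=> i j; rewrite stepC wC.
rewrite big1 ?add0r; last by move=> i iS; rewrite IHw// mulr0.
rewrite -mulr_sumr swap; under eq_bigr do under eq_bigr do rewrite wC.
have -> : \sum_(i in S) \sum_(j in S :\ i) w i j (step x j) =
          \sum_(i in S) \sum_(j in S :\ i) w i j x.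
  apply: eq_bigr => i iS; have := IHw i x iS; rewrite big_split/=.
  move=> /(congr1 (+%R^~ (\sum_(j in S :\ i) w i j x))).
  by rewrite -addrA addrr2 addr0 add0r.
by rewrite sum_sym_char2 ?mulr0 // => i j; exact: wC.
Qed.

(** Hence the product is exact, the coboundary of g_l times the product of the
    remaining cochains (Leibniz rule). *)
Lemma cup_exact l L S x :
  cup (l :: L) S x =
  \sum_(i in S) diff i (fun y => g l y * cup L (S :\ i) y) x.
Proof.
transitivity (cup (l :: L) S x + g l x * \sum_(i in S) diff i (cup L (S :\ i)) x).
  by rewrite cup_closed mulr0 addr0.
rewrite /= mulr_sumr -!big_split/=; apply: eq_bigr => i iS.
by rewrite /diff mulrDl mulrDr -addrA [X in _ + X]addrA addrr2 add0r.
Qed.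

Fixpoint gsum L h x : Z :=
  if L is l :: L' then \sum_(t < K) gsum L' h (upd x l t) else h x.

Lemma gsum_ext L h1 h2 x :
  (forall y, (forall i, i \notin L -> y i = x i) ->
             (forall i, i \in L -> (y i < K)%N) -> h1 y = h2 y) ->
  uniq L -> gsum L h1 x = gsum L h2 x.
Proof.
elim: L x => [|l L IH] x /= h12; first by move=> _; apply: h12.
move=> /andP[lL uL]; apply: eq_bigr => t _; apply: IH => // y yx yK; apply: h12 => i.
  rewrite inE negb_or => /andP[il iL].
  by rewrite yx// /upd (negbTE il).
rewrite inE => /orP[/eqP->|]; last exact: yK.
by rewrite yx// /upd eqxx.
Qed.

Lemma gsum0 L x : gsum L (fun=> 0) x = 0.
Proof. by elim: L x => //= l L IH x; rewrite big1. Qed.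

Lemma gsum_sum (I : finType) (P : pred I) L (h : I -> pt -> Z) x :
  gsum L (fun y => \sum_(i | P i) h i y) x = \sum_(i | P i) gsum L (h i) x.
Proof.
elim: L x => //= l L IH x; under eq_bigr do rewrite IH.
by rewrite exchange_big.
Qed.

Lemma gsum_step L h i x : i \notin L ->
  gsum L (diff i h) x = gsum L h (step x i) + gsum L h x.
Proof.
elim: L x => //= l L IH x; rewrite inE negb_or => /andP[il iL].
rewrite -big_split/=; apply: eq_bigr => t _; rewrite IH//; congr (gsum _ _ _ + _).
apply: funext => j; rewrite /step /upd; case: eqVneq => // ->.
by rewrite eq_sym (negbTE il) addn0.
Qed.

(** The fundamental theorem of calculus in direction i: the sum telescopes. *)
Lemma gsum_diff L h i x : i \notin L ->
  gsum (i :: L) (diff i h) x = gsum L h (upd x i K) + gsum L h (upd x i 0).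
Proof.
move=> iL /=; elim: K => [|k IH]; first by rewrite big_ord0 addrr2.
rewrite big_ord_recr/= IH gsum_step//.
have -> : step (upd x i k) i = upd x i k.+1.
  by apply: funext => j; rewrite /step /upd; case: eqP; rewrite ?addn1 ?addn0.
rewrite addrC -addrA; congr (_ + _).
by rewrite addrA addrr2 add0r.
Qed.

Lemma gsum_face0 L h i x : (forall y, y i = 0%N \/ y i = K -> h y = 0) ->
  i \in L -> uniq L -> gsum L (diff i h) x = 0.
Proof.
move=> h0; elim: L x => // l L IH x; rewrite inE => iL /= /andP[lL uL].
case: (boolP (i \in L)) iL => [iL _|iL].
  by rewrite big1// => t _; exact: IH.
rewrite orbF => /eqP il; have /= := gsum_diff h x iL; rewrite -il => ->.
have face t : t = 0%N \/ t = K -> gsum L h (upd x i t) = 0.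
  move=> tK; rewrite -(gsum0 L (upd x i t)); apply: gsum_ext => // y yx _.
  by apply: h0; rewrite yx// /upd eqxx.
by rewrite !face ?addr0; auto.
Qed.

Hypothesis g_lo : forall i x, x i = 0%N -> g i x = 0.
Hypothesis g_hi : forall i x, x i = K -> g i x = 1.

(** On a face x_i = 0 or x_i = K the cochain g_i is constant, so its coboundary
    kills every cube that lies in the face. *)
Lemma cup_face L S i x : i \in L -> i \notin S -> x i = 0%N \/ x i = K ->
  cup L S x = 0.
Proof.
elim: L S x => //= l L IH S x; rewrite inE => /orP[/eqP<-|iL] iS xi.
  rewrite big1// => j jS.
  have xj : step x j i = x i.
    rewrite /step; have [ij|_] := eqVneq i j; last by rewrite addn0.
    by rewrite ij jS in iS.
  rewrite /diff; case: xi => xi; first by rewrite !g_lo ?xj// addrr2 mul0r.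
  by rewrite !g_hi ?xj// addrr2 mul0r.
rewrite big1// => j jS; rewrite IH ?mulr0//.
  by rewrite !inE negb_and iS orbT.
rewrite /step; have [ij|_] := eqVneq i j; last by rewrite addn0.
by rewrite ij jS in iS.
Qed.

(** Discrete degree computation.  By exactness the grid total of the product is
    a sum over the boundary faces; the boundary conditions kill all of them
    except the face x_l = K, on which g_l = 1 leaves the same total with one
    coordinate less. *)
Lemma gsum_cup L x : uniq L -> (forall i, i \notin L -> x i = K) ->
  gsum L (cup L [set i in L]) x = 1.
Proof.
elim: L x => // l L IH x; rewrite cons_uniq => /andP[lL uL] xK.
pose h i y := g l y * cup L ([set j in l :: L] :\ i) y.
transitivity (gsum (l :: L)
    (fun y => \sum_(i in [set j in l :: L]) diff i (h i) y) x).
  by apply: gsum_ext => /=; [move=> y _ _; exact: cup_exact|rewrite lL].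
rewrite gsum_sum (bigD1 l)/=; last by rewrite !inE eqxx.
rewrite [X in _ + X]big1 ?addr0 => [|i /andP[]]; last first.
  rewrite !inE => /orP[/eqP->|iL il]; first by rewrite eqxx.
  have hi0 y : y i = 0%N \/ y i = K -> h i y = 0.
    move=> yi; rewrite /h (@cup_face _ _ i) ?mulr0//.
    by rewrite !inE eqxx.
  have iLL : i \in l :: L by rewrite inE iL orbT.
  by have /= -> := gsum_face0 x hi0 iLL; rewrite ?lL.
have /= -> := gsum_diff (h l) x lL.
have -> : gsum L (h l) (upd x l 0) = 0.
  rewrite -(gsum0 L (upd x l 0)); apply: gsum_ext => // y yx _.
  by rewrite /h g_lo ?mul0r// yx// /upd eqxx.
rewrite addr0 -(IH (upd x l K))//; last first.
  move=> i iL; rewrite /upd; case: eqVneq => // il; apply: xK.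
  by rewrite inE negb_or il iL.
apply: gsum_ext => // y yx _.
rewrite /h g_hi ?mul1r ?yx//; last by rewrite /upd eqxx.
congr (cup _ _ _); apply/finset.setP => i; rewrite !inE.
by case: eqVneq => // ->; rewrite (negbTE lL).
Qed.

(** A nonzero product has a nonzero edge path in its expansion; p and q are the
    ends of the edge of that path weighted by l. *)
Lemma cup_neq0 L S x l : cup L S x != 0 -> l \in L ->
  exists p q, [/\ forall j, (x j <= p j <= x j + (j \in S))%N,
                  forall j, (x j <= q j <= x j + (j \in S))%N
                & g l p != g l q].
Proof.
elim: L S x => //= k L IH S x.
case: (boolP [exists i, (i \in S) && (diff i (g k) x * cup L (S :\ i) (step x i) != 0)]);
  last first.
  move=> /existsPn/= h; rewrite big1 ?eqxx// => i iS.
  by have := h i; rewrite iS/= negbK => /eqP.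
move=> /existsP/= [i /andP[iS hi]] _; rewrite inE => /orP[/eqP->|lL].
  exists x, (step x i); split=> [j|j|].
  - by rewrite leqnn leq_addr.
  - by rewrite leq_addr leq_add2l; case: eqVneq => // ->; rewrite iS.
  - apply: contraNneq hi; rewrite /diff => <-; by rewrite addrr2 mul0r.
have hL : cup L (S :\ i) (step x i) != 0.
  by apply: contraNneq hi => ->; rewrite mulr0.
have [p [q [hp hq pq]]] := IH _ _ hL lL; exists p, q.
have widen z : (forall j, step x i j <= z j <= step x i j + (j \in S :\ i))%N ->
    forall j, (x j <= z j <= x j + (j \in S))%N.
  move=> hz j; have /andP[h1 h2] := hz j.
  rewrite (leq_trans _ h1) ?leq_addr//= (leq_trans h2)// /step -addnA leq_add2l !inE.
  by case: eqVneq => // ->; rewrite iS.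
by split=> //; exact: widen.
Qed.

End kuhn.

(** Kuhn's cubical form of Sperner's lemma: since the total of the cup product
    is 1, some unit cube has a nonzero contribution, and each label changes
    inside that cube. *)
Lemma kuhn_cubical (T : finType) K (b : T -> (T -> nat) -> bool) :
  (forall i x, x i = 0%N -> b i x = false) ->
  (forall i x, x i = K -> b i x = true) ->
  exists y : T -> nat, (forall i, y i < K)%N /\
    forall i, exists p q,
      [/\ forall j, (y j <= p j <= (y j).+1)%N, forall j, (y j <= q j <= (y j).+1)%N,
          b i p = false & b i q = true].
Proof.
move=> b_lo b_hi; have addrr2 (a : 'F_2) : a + a = 0.
  exact: (addrr_pchar2 (pchar_Fp (isT : prime 2))).
pose g i x : 'F_2 := (b i x)%:R.
have g_lo i x : x i = 0%N -> g i x = 0 by move=> xi; rewrite /g b_lo.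
have g_hi i x : x i = K -> g i x = 1 by move=> xi; rewrite /g b_hi.
pose c y := cup g (enum T) [set i in enum T] y.
have [[y [yK y0]]|none] := pselect (exists y, (forall i, y i < K)%N /\ c y != 0).
  exists y; split=> // i.
  have [p [q [yp yq]]] := cup_neq0 addrr2 y0 (mem_enum T i).
  have up z : (forall j, y j <= z j <= y j + (j \in [set i in enum T]))%N ->
      forall j, (y j <= z j <= (y j).+1)%N.
    by move=> yz j; have := yz j; rewrite inE mem_enum addn1.
  rewrite /g; case Ep : (b i p); case Eq : (b i q); rewrite ?eqxx// => _.
    by exists q, p; split=> //; exact: up.
  by exists p, q; split=> //; exact: up.
have := @gsum_cup _ addrr2 _ K g g_lo g_hi (enum T) (fun=> K) (enum_uniq T).
rewrite -/c (@gsum_ext _ _ K (enum T) c (fun=> 0)) ?enum_uniq//.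
  rewrite gsum0 => /(_ (fun i _ => erefl)) /esym/eqP.
  by rewrite oner_eq0.
move=> y _ yK; apply/eqP; apply: contraPT none => cy; apply; exists y; split=> // i.
by apply: yK; rewrite mem_enum.
Qed.

(** * The Poincare-Miranda theorem *)

Section miranda.
Context {R : realType}.

Lemma rV_norm_le n (v : 'rV[R]_n) (r : R) : 0 <= r ->
  (`|v| <= r) <-> (forall i, `|v 0 i| <= r).
Proof.
move=> r0; have -> : `|v| = \big[Num.max/0]_ij `|v ij.1 ij.2| by exact: mx_normrE.
split.
  move=> /bigmax_leP[_ vr] i; exact: (vr (0, i)).
by move=> vr; apply/bigmax_leP; split=> // -[j i] _; rewrite /= (ord1 j).
Qed.

(** The label of a grid point records, for each i, the sign of the i-th component
    of F.  Kuhn's lemma yields, in grids of mesh tending to 0, cells on which each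
    component takes both signs; at a cluster point of these cells every component
    vanishes by continuity. *)
Lemma poincare_miranda n (F : 'rV[R]_n -> 'rV[R]_n) (c : 'rV[R]_n) (r : R) :
  0 < r -> continuous F ->
  (forall x i, `|x - c| <= r -> x 0 i = c 0 i - r -> F x 0 i <= 0) ->
  (forall x i, `|x - c| <= r -> x 0 i = c 0 i + r -> 0 <= F x 0 i) ->
  exists2 x, `|x - c| <= r & F x = 0.
Proof.
move=> r0 Fcont F_lo F_hi.
pose cube := [set x : 'rV[R]_n | `|x - c| <= r].
have cell k : exists z, cube z /\ forall i, exists p q,
    [/\ `|p - z| <= 2 * r / k.+1%:R, `|q - z| <= 2 * r / k.+1%:R,
        F p 0 i <= 0 & 0 <= F q 0 i].
  pose pt (x : 'I_n -> nat) := \row_i (c 0 i + (2 * (x i)%:R / k.+1%:R - 1) * r).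
  have pt_cube x : (forall i, x i <= k.+1)%N -> cube (pt x).
    move=> xk; apply/rV_norm_le => [|i]; first exact: ltW.
    rewrite !mxE addrAC subrr add0r normrM (gtr0_norm r0) ler_piMl ?(ltW r0)//.
    have h0 : 0 <= (x i)%:R / k.+1%:R :> R by rewrite divr_ge0.
    have h1 : (x i)%:R / k.+1%:R <= 1 :> R by rewrite ler_pdivrMr// mul1r ler_nat.
    by rewrite ler_norml -mulrA; move: h0 h1; set u := _ / _ => h0 h1; apply/andP; split; lra.
  have pt_near x y : (forall j, y j <= x j <= (y j).+1)%N ->
      `|pt x - pt y| <= 2 * r / k.+1%:R.
    move=> yx; apply/rV_norm_le => [|i]; first by rewrite divr_ge0// mulr_ge0// ltW.
    have /andP[h1 h2] := yx i.
    have -> : (pt x - pt y) 0 i = (2 * r / k.+1%:R) * ((x i)%:R - (y i)%:R).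
      by rewrite !mxE; ring.
    rewrite normrM ger0_norm ?divr_ge0 ?mulr_ge0 ?(ltW r0)// ler_piMr//.
      by rewrite divr_ge0// mulr_ge0// ltW.
    rewrite -natrB// ger0_norm// lern1; lia.
  (* on the faces the label is prescribed: the sign of F there is only weak *)
  pose b i x := if x i == 0%N then false else
                if x i == k.+1 then true else 0 < F (pt x) 0 i.
  have [||y [yk ybr]] := @kuhn_cubical 'I_n k.+1 b.
  - by move=> i x xi; rewrite /b xi.
  - by move=> i x xi; rewrite /b xi eqxx.
  exists (pt y); split; first by apply: pt_cube => i; exact: ltnW.
  move=> i; have [p [q [yp yq bp bq]]] := ybr i; exists (pt p), (pt q).
  have in_cube z : (forall j, y j <= z j <= (y j).+1)%N -> cube (pt z).
    move=> yz; apply: pt_cube => j; have /andP[_ zy] := yz j.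
    exact: leq_trans zy (yk j).
  split; [exact: pt_near|exact: pt_near| |].
    move: bp; rewrite /b; case: eqP => [p0 _|_].
      by apply: F_lo; [exact: in_cube|rewrite mxE p0; ring].
    by case: eqP => // _ /negbT; rewrite -leNgt.
  move: bq; rewrite /b; case: eqP => // _; case: eqP => [qk _|_ /ltW//].
  by apply: F_hi; [exact: in_cube|rewrite mxE qk mulfK ?pnatr_eq0//; ring].
have [z_ z_cell] := choice cell.
have cube_cpt : compact cube.
  have -> : cube = [set v | forall i, v ord0 i \in `[c 0 i - r, c 0 i + r]].
    apply/seteqP; split=> v /=.
      move=> vr i; have /rV_norm_le/(_ i) := vr.
      by rewrite !mxE ler_distl in_itv/=; apply; exact: ltW.
    move=> vr; apply/rV_norm_le => [|i]; first exact: ltW.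
    by have := vr i; rewrite !mxE ler_distl in_itv.
  apply: (@rV_compact _ _ (fun i => `[c 0 i - r, c 0 i + r]%classic)) => i.
  exact: segment_compact.
have z_cube : \forall k \near \oo, cube (z_ k).
  by near=> k; exact: (z_cell k).1.
have [z [cz z_clust]] := cube_cpt (z_ @ \oo) _ z_cube.
exists z => //; apply/rowP => i; rewrite [RHS]mxE.
have coordF : {for z, continuous (fun x => F x 0 i)}.
  by apply: continuous_comp (Fcont z) (@coord_continuous _ _ _ 0 i (F z)).
(* a neighbourhood of z on which F _ 0 i keeps its sign contains cells *)
have both (P : set R) : open P -> P (F z 0 i) ->
    (exists2 p, P (F p 0 i) & F p 0 i <= 0) /\ (exists2 q, P (F q 0 i) & 0 <= F q 0 i).
  move=> oP Pz.
  have : nbhs z [set x | P (F x 0 i)] by apply: coordF; exact: open_nbhs_nbhs.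
  move=> /nbhs_ballP[e/= e0 eP].
  have small : \forall k \near \oo, 2 * r / k.+1%:R < e / 2.
    have er : 0 < e / 2 / (2 * r) by rewrite !divr_gt0// mulr_gt0.
    have := near_infty_natSinv_lt (PosNum er); apply: filterS => k /=.
    by rewrite ltr_pdivlMr ?mulr_gt0// mulrC.
  have [||w [[k /= ke <-] /= zw]] :=
      z_clust [set z_ k | k in [set k | 2 * r / k.+1%:R < e / 2]] (ball z (e / 2)).
  - by apply: filterS small => k ke; exists k.
  - by apply: nbhsx_ballx; rewrite divr_gt0.
  have [p [q [zp zq Fp Fq]]] := (z_cell k).2 i.
  have inP v : `|v - z_ k| <= 2 * r / k.+1%:R -> P (F v 0 i).
    move=> vz; apply: eP; rewrite (splitr e); apply: ball_triangle zw _.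
    by rewrite -ball_normE /= distrC; exact: le_lt_trans vz ke.
  by split; [exists p => //; exact: inP|exists q => //; exact: inP].
case: (ltgtP (F z 0 i) 0) => // Fz.
  have [_ [q]] := both [set t | t < 0] (@open_lt _ _) Fz.
  by move=> /= /lt_le_trans h /h; rewrite ltxx.
have [[p /= + + _]] := both [set t | 0 < t] (@open_gt _ _) Fz.
by move=> /lt_le_trans h /h; rewrite ltxx.
Unshelve. all: by end_near. Qed.

End miranda.

(** * Solving an equation to first order *)

Section local.
Context {R : realType}.

(** Differentiability at x0 with the derivative as a matrix acting on row vectors,
    in a form that also applies to x - f x without computing a Jacobian. *)
Definition first_order n m (F : 'rV[R]_n -> 'rV[R]_m) x0 (M : 'M[R]_(n, m)) :=
  forall e, 0 < e -> \forall x \near x0,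
    `|F x - F x0 - (x - x0) *m M| <= e * `|x - x0|.

Lemma differentiable_first_order n m (F : 'rV[R]_n -> 'rV[R]_m) x0 :
  differentiable F x0 -> first_order F x0 ('J F x0).
Proof.
move=> /diff_locallyP[_ /eqaddoP dF] e e0.
have /nbhs_ballP[d/= d0 hd] := dF e e0.
apply/nbhs_ballP; exists d => //= x; rewrite -ball_normE/= => xd.
have /hd/= : ball 0 d (x - x0) by rewrite -ball_normE/= sub0r opprB.
by rewrite !fctE subrK /jacobian mul_rV_lin1 opprD addrA.
Qed.

Lemma mulmx_lipschitz n m (M : 'M[R]_(n, m)) :
  exists2 C, 0 < C & forall v : 'rV[R]_n, `|v *m M| <= C * `|v|.
Proof.
pose C := 1 + \sum_i \sum_j `|M i j|.
have C0 : 0 < C.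
  by rewrite ltr_pwDl// sumr_ge0// => i _; rewrite sumr_ge0.
exists C => // v; apply/rV_norm_le => [|j]; first by rewrite mulr_ge0// ltW.
rewrite mxE (le_trans (ler_norm_sum _ _ _))//.
rewrite /C mulrDl mul1r ler_wpDl// mulr_suml ler_sum// => i _.
rewrite normrM mulrC ler_pM//.
  by rewrite (bigD1 j)//= lerDl sumr_ge0.
by have /rV_norm_le -> := lexx `|v|.
Qed.

Lemma mulmxr_continuous n m (M : 'M[R]_(n, m)) :
  continuous (fun v : 'rV[R]_n => v *m M).
Proof.
have [C C0 lip] := mulmx_lipschitz M.
move=> v; apply/(@cvgrPdist_le _ _ _ _ (nbhs_filter v)) => e e0; apply/nbhs_ballP.
exists (e / C) => /= [|w]; first exact: divr_gt0.
rewrite -ball_normE/= => vw; rewrite -mulmxBl (le_trans (lip _))// mulrC.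
by rewrite -ler_pdivlMr// ltW.
Qed.

(** Every first-order move x0 + t h is realised, up to an error e t, by an exact
    solution of F x = F x0 + t h M.  The map G of the proof is the defect of the
    equation with the linear part M undone: near the centre x0 + t h it differs from
    x - (x0 + t h) by o(t), so on the cube of radius e t its components have the signs
    required by Poincare-Miranda.  Differentiability at the single point x0 and
    continuity suffice; an inverse function theorem would ask for more. *)
Lemma local_solve n (F : 'rV[R]_n -> 'rV[R]_n) x0 (M : 'M[R]_n) h e :
  continuous F -> first_order F x0 M -> M \in unitmx -> 0 < e ->
  \forall t \near 0^'+,
    exists2 x, `|x - (x0 + t *: h)| <= e * t & F x = F x0 + t *: (h *m M).
Proof.
move=> Fcont FM Mu e0.
have [C C0 lip] := mulmx_lipschitz (invmx M).
have he : 0 < `|h| + e by rewrite ltr_wpDl.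
(* |x - x0| <= t (|h| + e) on the cube, so this eta makes the error of G there at
   most C * eta * t * (|h| + e) = e * t *)
pose eta := e / (C * (`|h| + e)).
have eta0 : 0 < eta by rewrite divr_gt0// mulr_gt0.
have /nbhs_ballP[d/= d0 rem] := FM eta eta0.
have td : \forall t \near 0^'+, t * (`|h| + e) < d.
  near=> t; rewrite -ltr_pdivlMr//; near: t.
  by apply: nbhs_right_lt; rewrite divr_gt0.
near=> t; have t0 : 0 < t by near: t; exact: nbhs_right_gt.
have et0 : 0 < e * t by rewrite mulr_gt0.
pose G x := (F x - F x0 - t *: (h *m M)) *m invmx M.
have Gx x : `|x - (x0 + t *: h)| <= e * t ->
    `|G x - (x - (x0 + t *: h))| <= e * t.
  move=> xt.
  have xx0 : `|x - x0| <= t * (`|h| + e).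
    have -> : x - x0 = (x - (x0 + t *: h)) + t *: h by rewrite opprD addrA subrK.
    rewrite (le_trans (ler_normD _ _))// normrZ gtr0_norm//.
    by rewrite mulrDr addrC lerD2l mulrC.
  have -> : G x - (x - (x0 + t *: h)) = (F x - F x0 - (x - x0) *m M) *m invmx M.
    have cancel (u w y z : 'rV[R]_n) : u - w - (y - (z + w)) = u - (y - z).
      by rewrite !opprB (addrC z w) -[w + z - y]addrA [LHS]addrA subrK.
    by rewrite /G !mulmxBl -scalemxAl !mulmxK// cancel.
  rewrite (le_trans (lip _))// mulrC -ler_pdivlMr//.
  have xd : ball x0 d x.
    rewrite -ball_normE/= distrC (le_lt_trans xx0)//; near: t; exact: td.
  rewrite (le_trans (rem _ xd))// (le_trans (ler_wpM2l (ltW eta0) xx0))//.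
  rewrite /eta le_eqVlt; apply/orP; left; apply/eqP; field.
  by rewrite !gt_eqF.
have [||||x xt Gx0] := @poincare_miranda R n G (x0 + t *: h) (e * t).
- exact: et0.
- move=> x; apply: (@continuous_comp _ _ _ (fun x => F x - F x0 - t *: (h *m M))
    (fun v => v *m invmx M)); last exact: mulmxr_continuous.
  apply: continuousB; last exact: cst_continuous.
  by apply: continuousB; [exact: Fcont|exact: cst_continuous].
- move=> x i xt xi; have /rV_norm_le := Gx x xt => /(_ (ltW et0) i).
  by rewrite !mxE xi !mxE ler_distl => /andP[_]; lra.
- move=> x i xt xi; have /rV_norm_le := Gx x xt => /(_ (ltW et0) i).
  by rewrite !mxE xi !mxE ler_distl => /andP[+ _]; lra.
exists x => //; move: Gx0 => /(congr1 (mulmx^~ M)).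
by rewrite mul0mx mulmxKV// => /eqP; rewrite subr_eq0 subr_eq addrC => /eqP.
Unshelve. all: by end_near. Qed.

End local.

(** * Submultiplicative norms and Neumann series *)

Section norms.
Context {R : realType} {n : nat}.
Variable N : 'M[R]_n.+1 -> R.
Hypothesis normN : submultiplicative_norm N.
Implicit Types M A : 'M[R]_n.+1.

(** A submultiplicative norm dominates every entry, because a product with two
    matrix units isolates M i j. *)
Lemma norm_entry : exists C, 0 <= C /\ forall M i j, `|M i j| <= C * N M.
Proof.
have [N0 Neq0 NZ ND NM] := normN.
have E0 : 0 < N (delta_mx 0 0).
  rewrite lt_neqAle N0 andbT eq_sym; apply/eqP => /Neq0/matrixP/(_ 0 0).
  by rewrite !mxE !eqxx => /eqP; rewrite oner_eq0.
pose w i j := N (delta_mx 0 i) * N (delta_mx j 0) / N (delta_mx 0 0).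
have w0 i j : 0 <= w i j by rewrite divr_ge0// mulr_ge0.
exists (\sum_i \sum_j w i j); split=> [|M i j].
  by rewrite sumr_ge0// => i _; rewrite sumr_ge0.
apply: (@le_trans _ _ (w i j * N M)); last first.
  rewrite ler_wpM2r// (bigD1 i)//= (bigD1 j)//= -addrA lerDl addr_ge0 ?sumr_ge0//.
  by move=> k _; rewrite sumr_ge0.
rewrite /w mulrAC ler_pdivlMr// -NZ.
have -> : M i j *: delta_mx 0 0 =
      delta_mx 0 i *m M *m delta_mx j 0 :> 'M[R]_n.+1.
  apply/matrixP => k l; rewrite !mxE (bigD1 j)//= big1 ?addr0 => [|p pj].
    rewrite !mxE (bigD1 i)//= big1 ?addr0 => [|p pi].
      by rewrite !mxE !eqxx; case: (k == 0); case: (l == 0); rewrite /=; ring.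
    by rewrite !mxE (negbTE pi) andbF mul0r.
  by rewrite [X in _ * X]mxE (negbTE pj) mulr0.
by rewrite mulrAC (le_trans (NM _ _))// ler_wpM2r.
Qed.

Lemma normX A k : N (A ^+ k.+1) <= N A ^+ k.+1.
Proof.
have [N0 _ _ _ NM] := normN; elim: k => // k IH.
by rewrite exprS [leRHS]exprS (le_trans (NM _ _))// ler_wpM2l.
Qed.

(** The kernel matrix X satisfies X = X A, hence N X <= N X * N A. *)
Lemma one_sub_unitmx A : N A < 1 -> 1 - A \in unitmx.
Proof.
have [N0 Neq0 _ _ NM] := normN; move=> A1.
rewrite -row_free_unit -kermx_eq0; apply/eqP/Neq0; set X := kermx _.
have XA : X = X *m A.
  by apply/eqP; rewrite -subr_eq0 -[X in X - _]mulmx1 -mulmxBr mulmx_ker.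
apply/eqP; rewrite eq_le N0 andbT leNgt; apply/negP => X0.
have := NM X A; rewrite -XA; apply/negP; rewrite -ltNge.
by rewrite gtr_pMr.
Qed.

Lemma geometric_sum A k : (0 < k)%N ->
  (\sum_(1 <= l < k) A ^+ l) * (1 - A) = A - A ^+ k.
Proof.
move=> k0; rewrite mulr_suml -[RHS]opprB -[X in A ^+ k - X]expr1.
rewrite -telescope_sumr// -sumrN; apply: eq_bigr => l _.
by rewrite mulrBr mulr1 opprB exprSr.
Qed.

(** The remainder after the terms of exponent at most k is A^(k+1) (1 - A)^-1,
    whose entries are bounded by a multiple of (N A)^(k+1). *)
Lemma neumann_series A : N A < 1 ->
  \big[+%R/0]_(1 <= l <oo) A ^+ l = invmx (1 - A) - 1.
Proof.
move=> A1; have [N0 Neq0 NZ _ NM] := normN.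
have Au := one_sub_unitmx A1; pose S := invmx (1 - A).
have SE : S - 1 = A *m S.
  rewrite -[X in S - X](mulmxV Au) -/S mulmxBl [1 *m S]mul1mx.
  by rewrite opprB addrC subrK.
have [C [C0 entry]] := norm_entry.
apply/cvg_lim; first exact: norm_hausdorff.
apply/cvgrPdist_le => e e0.
have K0 : 0 <= C * N S by rewrite mulr_ge0.
have rho : `|N A| < 1 by rewrite ger0_norm.
have := cvg_expr rho => /cvgrPdist_le /(_ (e / (C * N S + 1))) [].
  by rewrite divr_gt0// ltr_wpDl.
move=> k0 _ small; exists k0.+1 => // -[//|k] /= k0k.
rewrite -/S SE.
have -> : A *m S - \sum_(1 <= l < k.+1) A ^+ l = A ^+ k.+1 *m S.
  have -> : \sum_(1 <= l < k.+1) A ^+ l = (A - A ^+ k.+1) *m S.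
    by rewrite -geometric_sum// [X in _ = X *m _]/GRing.mul/= mulmxK.
  by rewrite mulmxBl opprB addrC subrK.
have -> : `|A ^+ k.+1 *m S| = \big[Num.max/0]_ij `|(A ^+ k.+1 *m S) ij.1 ij.2|.
  exact: mx_normrE.
apply/bigmax_leP; split=> [|[i j] _ /=]; first exact: ltW.
rewrite (le_trans (entry _ i j))// (le_trans (ler_wpM2l C0 (NM _ _)))//.
have /= := small k.+1 (leqW k0k); rewrite sub0r normrN ger0_norm ?exprn_ge0//.
rewrite ler_pdivlMr ?ltr_wpDl// => h.
rewrite mulrCA (le_trans _ h)// ler_pM ?mulr_ge0 ?normX//.
by rewrite lerDl.
Qed.

Lemma le_geometric0 (x B rho : R) : 0 <= rho < 1 ->
  (forall k, x <= B * rho ^+ k) -> x <= 0.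
Proof.
move=> /andP[rho0 rho1] xB.
have lim0 : (fun k => B * rho ^+ k) @ \oo --> B * 0.
  by apply: cvgMr; apply: cvg_expr; rewrite ger0_norm.
rewrite -(mulr0 B) -(cvg_lim _ lim0)//; apply: limr_ge; first by apply: cvgP lim0.
exact: nearW.
Qed.

(** Iterating l = v + A^k l gives l >= v + A^(k L) l for every L >= 1, as A^k and v
    are nonnegative; the last term tends to 0. *)
Lemma nonneg_power_fixed A k (v l : 'cV[R]_n.+1) : N A < 1 -> (0 < k)%N ->
  lemx 0 (A ^+ k) -> lemx 0 v -> l = v + A ^+ k *m l -> lemx v l.
Proof.
move=> A1 k0 Ak0 v0 lE i j; rewrite (ord1 j) -subr_le0 {j}.
have [N0 Neq0 NZ _ NM] := normN.
have lEi p : l p 0 = v p 0 + (A ^+ k *m l) p 0 by rewrite {1}lE mxE.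
have iter L : v i 0 - l i 0 <= - (A ^+ (k * L.+1) *m l) i 0.
  rewrite lerBlDr addrC -lerBlDr opprK.
  elim: L i => [|L IH] i; first by rewrite muln1 [leRHS]lEi.
  rewrite [leRHS]lEi lerD2l mulnS exprD -mulmxA !mxE ler_sum// => p _.
  rewrite ler_wpM2l//; first by have := Ak0 i p; rewrite mxE.
  by apply: le_trans (IH p); rewrite lerDr; have := v0 p 0; rewrite mxE.
have [C [C0 entry]] := norm_entry.
pose l' : 'M[R]_n.+1 := l *m delta_mx 0 0.
have l'E (M : 'M[R]_n.+1) : (M *m l') i 0 = (M *m l) i 0.
  rewrite mulmxA mxE (bigD1 0)//= big1 ?addr0; last by move=> p; rewrite ord1.
  by rewrite [X in _ * X]mxE !eqxx mulr1.
apply: (@le_geometric0 _ (C * N l') (N A)); first by rewrite N0 A1.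
move=> L; apply: le_trans (iter L) _.
rewrite -l'E (le_trans (ler_norm _))// normrN (le_trans (entry _ _ _))//.
rewrite -mulrA ler_wpM2l// (le_trans (NM _ _))// mulrC ler_wpM2l//.
have kL : (0 < k * L.+1)%N by rewrite muln_gt0 k0.
rewrite -(prednK kL) (le_trans (normX _ _))// prednK//.
by rewrite ler_wiXn2l// ?ltW//; nia.
Qed.

End norms.

(** * Positivity of the multipliers *)

Section multipliers.
Context {R : realType} {n m : nat}.
Implicit Types (G : 'M[R]_(n.+1, m.+1)) (mu : 'rV[R]_m.+1).

Lemma weighted_gradient_gt0 G mu : lemx 0 G -> (forall i, row i G != 0) ->
  ltmx 0 mu -> forall i, 0 < (G *m mu^T) i 0.
Proof.
move=> G0 Grow mu0 i; rewrite mxE.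
have [j Gij] : exists j, G i j != 0.
  apply/existsP; apply: contraNT (Grow i) => /existsPn/= h.
  by apply/eqP/rowP => j; rewrite !mxE; apply/eqP; have := h j; rewrite negbK.
have pos k : 0 <= G i k * mu^T k 0.
  rewrite mulr_ge0//; first by have := G0 i k; rewrite mxE.
  by rewrite mxE; have := mu0 0 k; rewrite mxE => /ltW.
rewrite (bigD1 j)//= ltr_wpDr ?sumr_ge0// mulr_gt0//.
  by rewrite lt_neqAle eq_sym Gij; have := G0 i j; rewrite mxE.
by rewrite mxE; have := mu0 0 j; rewrite mxE.
Qed.

(** In each column of G the least entry is at least q times the largest one, and
    this passes to nonnegative combinations of the columns. *)
Lemma q_ratio_mul_le G mu i j : lemx 0 G -> ltmx 0 mu ->
  q_ratio G * (G *m mu^T) j 0 <= (G *m mu^T) i 0.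
Proof.
move=> G0 mu0; rewrite !mxE mulr_sumr ler_sum// => l _.
rewrite mulrA ler_wpM2r//.
  by rewrite mxE; have := mu0 0 l; rewrite mxE => /ltW.
have Gge0 k : 0 <= G k l by have := G0 k l; rewrite mxE.
have qle : q_ratio G <= col_min G l / col_max G l by exact: bigmin_le_cond.
have min_le k : col_min G l <= G k l by exact: bigmin_le_cond.
have le_max k : G k l <= col_max G l by exact: (@le_bigmax _ _ _ (G ord0 l) (fun i => G i l) k).
have max0 : 0 <= col_max G l by exact: le_trans (le_max 0).
have [max_eq0|max_neq0] := eqVneq (col_max G l) 0.
  have -> : G j l = 0 by apply/eqP; rewrite eq_le Gge0 -{1}max_eq0 le_max.
  by rewrite mulr0.
have maxgt0 : 0 < col_max G l by rewrite lt_neqAle eq_sym max_neq0.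
apply: le_trans (min_le i).
apply: (@le_trans _ _ (col_min G l / col_max G l * G j l)).
  by rewrite ler_wpM2r.
rewrite -mulrA ler_piMr//; last by rewrite mulrC ler_pdivrMr// mul1r.
by rewrite /col_min; apply/bigmin_geP.
Qed.

(** With c = G mu, the vector E c is bounded entrywise by |E| max c, which is less
    than q max c <= min c. *)
Lemma small_perturbation_gt0 G mu (E : 'M[R]_n.+1) :
  lemx 0 G -> (forall i, row i G != 0) -> ltmx 0 mu ->
  norm_infty E < q_ratio G ->
  forall i, 0 < ((1 + E) *m (G *m mu^T)) i 0.
Proof.
move=> G0 Grow mu0 Eq i; have c0 := weighted_gradient_gt0 G0 Grow mu0.
set c := G *m mu^T in c0 *.
have [j0 jmax] : exists j0, forall j, c j 0 <= c j0 0.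
  by case: (@arg_maxP _ _ _ 0 xpredT (fun j => c j 0)) => // j0 _ h; exists j0 => j; exact: h.
rewrite mulmxDl mul1mx mxE -[ltLHS](subrr (c i 0)) ltrD2l.
suff : `|(E *m c) i 0| < c i 0 by rewrite ltr_norml => /andP[].
apply: (@le_lt_trans _ _ (norm_infty E * c j0 0)); last first.
  by apply: lt_le_trans (q_ratio_mul_le i j0 G0 mu0); rewrite ltr_pM2r.
apply: (@le_trans _ _ ((\sum_j `|E i j|) * c j0 0)); last first.
  rewrite ler_wpM2r//; first exact: ltW.
  exact: (@le_bigmax _ _ _ 0 (fun i => \sum_j `|E i j|) i).
rewrite mxE (le_trans (ler_norm_sum _ _ _))// mulr_suml ler_sum// => j _.
by rewrite normrM ler_wpM2l// gtr0_norm.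
Qed.

(** The Lagrange multipliers lam = (1 - A)^-1 c are positive.  For k infinite,
    (1 - A)^-1 is 1 + E with E the sum of all powers of positive exponent, so the
    previous estimate applies.  For k finite, (1 + E)(1 - A) = 1 - A^k with E the sum
    of the powers of exponent 1, ..., k-1, so lam = (1 + E) c + A^k lam with
    (1 + E) c > 0 and A^k >= 0. *)
Lemma multiplier_gt0 N (fobj : 'rV[R]_n.+1 -> 'rV[R]_m.+1) f x mu :
  submultiplicative_norm N -> gqc_at N fobj f x -> ltmx 0 mu ->
  forall i, 0 < (invmx (1 - 'J f x) *m ('J fobj x *m mu^T)) i 0.
Proof.
move=> normN [G0 Grow A1 [k order]] mu0.
set A := 'J f x in A1 order *; set G := 'J fobj x in G0 Grow order *.
have Au := one_sub_unitmx normN A1.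
case: k order => [k|] /= order; last first.
  rewrite (neumann_series normN A1) in order.
  have := small_perturbation_gt0 G0 Grow mu0 order.
  by rewrite addrC subrK.
case: order => k0 Ak0 sum_lt.
pose E := \sum_(1 <= l < k) A ^+ l.
pose v := (1 + E) *m (G *m mu^T).
have v0 i : 0 < v i 0.
  have [k1|] := ltnP 1 k; first exact: small_perturbation_gt0 (sum_lt k1) i.
  move=> k1; rewrite /v /E big_geq// addr0 mul1mx.
  exact: weighted_gradient_gt0.
set lam := invmx _ *m _.
have lamE : lam = v + A ^+ k *m lam.
  apply/eqP; rewrite -subr_eq -[X in X - _]mul1mx -mulmxBl.
  have -> : 1%:M - A ^+ k = (1 + E) *m (1 - A).
    by rewrite mulmxDl mul1mx [E *m _]geometric_sum// addrA subrK.
  by rewrite /lam -mulmxA mulKVmx.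
have := nonneg_power_fixed normN A1 k0 Ak0 _ lamE => le_vl i.
apply: lt_le_trans (v0 i) (le_vl _ i 0) => p j.
by rewrite mxE (ord1 j) ltW.
Qed.

End multipliers.

(** * Uniqueness of the fixed point *)

Section fixed.
Context {R : realType} {n : nat}.

Lemma differentiable_rV p q (f : 'rV[R]_p -> 'rV[R]_q) x :
  (forall i, differentiable (fun y => f y 0 i : R^o) x) -> differentiable f x.
Proof.
move=> df.
have -> : f = \sum_(i < q) (fun y => f y 0 i *: (delta_mx 0 i : 'rV[R]_q)).
  by apply/funext => y; rewrite fct_sumE -row_sum_delta.
by apply: differentiable_sum => i; apply: differentiableZl; exact: df.
Qed.

Variable N : 'M[R]_n.+1 -> R.
Hypothesis normN : submultiplicative_norm N.

(** A norm on vectors compatible with N: v is replaced by the square matrix all of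
    whose rows are v. *)
Definition row_norm (v : 'rV[R]_n.+1) := N (const_mx 1 *m v).

Lemma row_norm_eq0 v : row_norm v = 0 -> v = 0.
Proof.
have [_ Neq0 _ _ _] := normN => /Neq0 /matrixP uv; apply/rowP => j.
by have := uv 0 j; rewrite mxE big_ord1 !mxE mul1r.
Qed.

Lemma row_norm0 : row_norm 0 = 0.
Proof.
have [_ _ NZ _ _] := normN.
by rewrite /row_norm mulmx0 -(scale0r 0) NZ normr0 mul0r.
Qed.

Lemma row_normZ c v : row_norm (c *: v) = `|c| * row_norm v.
Proof. by have [_ _ NZ _ _] := normN; rewrite /row_norm -scalemxAr NZ. Qed.

Lemma row_normD u v : row_norm (u + v) <= row_norm u + row_norm v.
Proof. by have [_ _ _ ND _] := normN; rewrite /row_norm mulmxDr ND. Qed.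

Lemma row_normM v A : row_norm (v *m A) <= row_norm v * N A.
Proof. by have [_ _ _ _ NM] := normN; rewrite /row_norm mulmxA NM. Qed.

Lemma row_norm_ge0 v : 0 <= row_norm v.
Proof. by have [N0 _ _ _ _] := normN; exact: N0. Qed.

Lemma row_norm_bound : exists2 C, 0 < C & forall v, row_norm v <= C * `|v|.
Proof.
pose C := 1 + \sum_(j < n.+1) row_norm (delta_mx 0 j).
have S0 : 0 <= \sum_(j < n.+1) row_norm (delta_mx 0 j).
  by rewrite sumr_ge0// => j _; exact: row_norm_ge0.
exists C => [|v]; first by rewrite ltr_pwDl.
have le_sum (r : seq 'I_n.+1) : row_norm (\sum_(j <- r) v 0 j *: delta_mx 0 j) <=
    \sum_(j <- r) `|v 0 j| * row_norm (delta_mx 0 j).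
  elim: r => [|j r IH]; first by rewrite !big_nil row_norm0.
  by rewrite !big_cons (le_trans (row_normD _ _))// row_normZ lerD2l.
rewrite {1}(row_sum_delta v) (le_trans (le_sum _))// mulrDl mul1r ler_wpDl//.
rewrite mulr_suml ler_sum// => j _; rewrite mulrC ler_wpM2l ?row_norm_ge0//.
by have /rV_norm_le -> := lexx `|v|.
Qed.

Lemma row_norm_continuous : continuous row_norm.
Proof.
have [C C0 bound] := row_norm_bound.
have lip u w : row_norm u - row_norm w <= C * `|u - w|.
  by rewrite lerBlDr (le_trans _ (lerD (bound _) (lexx _)))// -{1}(subrK w u) row_normD.
move=> v; apply/(@cvgrPdist_le _ _ _ _ (nbhs_filter v)) => e e0; apply/nbhs_ballP.
exists (e / C) => /= [|w]; first exact: divr_gt0.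
rewrite -ball_normE/= => vw; have vwC : C * `|v - w| <= e.
  by rewrite mulrC -ler_pdivlMr// ltW.
rewrite ler_norml; apply/andP; split; last exact: le_trans (lip v w) vwC.
by rewrite lerNl opprB (le_trans (lip w v))// distrC.
Qed.

(** The Jacobian need not be continuous or uniformly bounded below 1, so the
    segment is not integrated over.  Instead, with v = x - y, the continuous function
    e t = |f (y + t v) - f y| - t |v| vanishes at 0 and 1, hence has a minimum on
    [0, 1] at some t0 < 1.  Right of t0 its first-order growth is at most
    (N J - 1) |v|, which is negative unless v = 0. *)
Lemma fixed_point_unique (f : 'rV[R]_n.+1 -> 'rV[R]_n.+1) a b x y :
  (forall z, differentiable f z) -> (forall z, box a b z -> N ('J f z) < 1) ->
  box a b x -> box a b y -> x = f x -> y = f y -> x = y.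
Proof.
move=> df contr bx by_ fx fy; apply/eqP; rewrite -subr_eq0; apply/negP => v0'.
move/negP : v0'; set v := x - y => v0.
have Vv : 0 < row_norm v.
  rewrite lt_neqAle row_norm_ge0 andbT eq_sym.
  by apply: contra_neq v0; exact: row_norm_eq0.
pose seg t := y + t *: v.
pose e t := row_norm (f (seg t) - f y) - t * row_norm v.
have seg_box t : 0 <= t <= 1 -> box a b (seg t).
  move=> /andP[t0 t1]; split=> j i; rewrite (ord1 j) !mxE;
  by have := bx.1 0 i; have := bx.2 0 i; have := by_.1 0 i; have := by_.2 0 i; nra.
have segC : continuous seg.
  by move=> t; apply: cvgD; [exact: cvg_cst|apply: cvgZl; exact: cvg_id].
have fC : continuous f by move=> z; exact: differentiable_continuous.
have eC : continuous e.
  move=> t; have c1 : {for t, continuous (fun t : R => row_norm (f (seg t) - f y))}.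
    apply: (@continuous_comp _ _ _ (fun t => f (seg t) - f y) row_norm);
      last exact: row_norm_continuous.
    apply: continuousB; last exact: cst_continuous.
    by apply: continuous_comp; [exact: segC|exact: fC].
  have c2 : {for t, continuous (fun t : R => t * row_norm v)}.
    by apply: continuousM; [exact: cvg_id|exact: cst_continuous].
  exact: cvgB c1 c2.
have e01 : e 0 = e 1.
  have seg0 : seg 0 = y by rewrite /seg scale0r addr0.
  have seg1 : seg 1 = x by rewrite /seg scale1r addrC subrK.
  by rewrite /e seg0 seg1 -fx -fy subrr row_norm0 mul0r mul1r !subrr.
have [t0 t0in t0min] : exists2 t0, 0 <= t0 < 1 & forall t, 0 <= t <= 1 -> e t0 <= e t.
  have [|c] := @EVT_min R e 0 1 ler01; first exact: continuous_subspaceT.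
  rewrite in_itv/= => /andP[c0 c1] cmin.
  have {}cmin t : 0 <= t <= 1 -> e c <= e t by move=> tt; apply: cmin; rewrite in_itv.
  move: c1; rewrite le_eqVlt => /orP[/eqP c1|c1]; last by exists c; rewrite ?c0.
  exists 0 => [|t tt]; first by rewrite lexx ltr01.
  by rewrite e01; have := cmin t tt; rewrite c1.
have /andP[t00 t01] := t0in.
have [C C0 bound] := row_norm_bound.
have z_box : box a b (seg t0) by apply: seg_box; rewrite t00 ltW.
set rho := N ('J f (seg t0)); have rho1 : rho < 1 := contr _ z_box.
have nv0 : 0 < `|v| by rewrite normr_gt0.
(* the error term C * eta * s * |v| then uses up half of s * (1 - rho) * |v| *)
pose eta := (1 - rho) * row_norm v / (2 * C * `|v|).
have eta0 : 0 < eta by rewrite divr_gt0 ?mulr_gt0 ?subr_gt0.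
have /nbhs_ballP[d/= d0 rem] := differentiable_first_order (df (seg t0)) eta0.
have [s s0 [s1 sd]] : exists2 s, 0 < s & t0 + s <= 1 /\ s * `|v| < d.
  exists (Num.min (1 - t0) (d / 2 / `|v|)).
    by rewrite lt_min subr_gt0 t01 !divr_gt0.
  split; first by rewrite -lerBrDl ge_min lexx.
  rewrite -ltr_pdivlMr// gt_min; apply/orP; right.
  by rewrite ltr_pM2r ?invr_gt0// ltr_pdivrMr// ltr_pMr// ltr1n.
have segS : seg (t0 + s) = seg t0 + s *: v by rewrite /seg scalerDl addrA.
have sz : seg (t0 + s) - seg t0 = s *: v by rewrite segS addrC addKr.
have := rem (seg (t0 + s)).
rewrite -ball_normE/= distrC sz normrZ gtr0_norm// => /(_ sd) rem_le.
have step : row_norm (f (seg (t0 + s)) - f (seg t0)) <=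
    s * (row_norm v * rho) + C * (eta * (s * `|v|)).
  rewrite -[X in row_norm X](subrK ((s *: v) *m 'J f (seg t0))) addrC.
  rewrite (le_trans (row_normD _ _))// lerD//.
    by rewrite -scalemxAl row_normZ gtr0_norm// ler_wpM2l ?row_normM// ltW.
  by rewrite (le_trans (bound _))// ler_wpM2l// ltW.
have := t0min (t0 + s); rewrite s1 addr_ge0 ?(ltW s0)// => /(_ isT).
rewrite /e => emin.
have tri : row_norm (f (seg (t0 + s)) - f y) <=
    row_norm (f (seg (t0 + s)) - f (seg t0)) + row_norm (f (seg t0) - f y).
  by rewrite (le_trans _ (row_normD _ _))// addrA subrK.
have etaE : C * (eta * (s * `|v|)) = s * ((1 - rho) * row_norm v / 2).
  by rewrite /eta; field; rewrite !gt_eqF.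
have : s * row_norm v <= s * (row_norm v * rho) + s * ((1 - rho) * row_norm v / 2).
  by rewrite -etaE; lra.
rewrite -mulrDr ler_pM2l//; have : 0 < (1 - rho) * row_norm v.
  by rewrite mulr_gt0 ?subr_gt0.
by lra.
Qed.

End fixed.

(** * Maximizers of weighted objectives *)

Section optimality.
Context {R : realType} {n m : nat}.

(** A slack constraint i could be tightened: along h = e_i (1 - J)^-1 the residuals
    x - f x change to first order by t e_i only, and the objective by t lam_i, where
    lam_i > 0 is the multiplier.  By local_solve the residuals can be made to change
    by exactly t e_i, so equality constraints are kept and a better feasible point
    appears.  That point may lie outside the box, where nothing is known about the
    Jacobians; this is why the exact solution comes from a topological argument and
    not from a contraction. *)
Lemma maximizer_fixed N (f0 : 'rV[R]_n.+1 -> 'rV[R]_m.+1)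
    (f : 'rV[R]_n.+1 -> 'rV[R]_n.+1) (A B : {set 'I_n.+1}) (mu : 'rV[R]_m.+1) x :
  submultiplicative_norm N -> B = ~: A ->
  (forall y, differentiable f0 y) -> (forall y, differentiable f y) ->
  gqc_at N f0 f x -> ltmx 0 mu ->
  maximizers (fun y => \sum_j mu 0 j * f0 y 0 j) (feasible f A B) x -> x = f x.
Proof.
move=> normN BA df0 df gx mu0 [[xA xB] xmax].
have [//|/eqP xf] := pselect (x = f x).
have /existsP[i xi] : [exists i, x 0 i != f x 0 i].
  apply: contraNT xf => /existsPn/= h; apply/eqP/rowP => i.
  by apply/eqP; have := h i; rewrite negbK.
have iA : i \in A.
  by apply: contraNT xi => iA; apply/eqP/xB; rewrite BA inE.
have slack : 0 < f x 0 i - x 0 i by rewrite subr_gt0 lt_neqAle xi xA.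
exfalso.
set J := 'J f x; set G := 'J f0 x.
have Ju : 1 - J \in unitmx by have [_ _ J1 _] := gx; exact: one_sub_unitmx J1.
pose h : 'rV[R]_n.+1 := delta_mx 0 i *m invmx (1 - J).
set lam := (invmx (1 - J) *m (G *m mu^T)) i 0.
have lam0 : 0 < lam := multiplier_gt0 normN gx mu0 i.
have hG : (h *m (G *m mu^T)) 0 0 = lam.
  by rewrite /h -mulmxA -rowE mxE.
have FJ : first_order (fun y => y - f y) x (1 - J).
  move=> e e0; have := differentiable_first_order (df x) e0; apply: filterS => y.
  rewrite mulmxBr mulmx1 -normrN; move: (_ *m J) => w.
  suff -> : - (f y - f x - w) = y - f y - (x - f x) - (y - x - w) by [].
  by apply/rowP => j; rewrite !mxE; ring.
have [C1 C10 lip1] := mulmx_lipschitz (G *m mu^T).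
have [C2 C20 lip2] := mulmx_lipschitz mu^T.
(* e and eta bound each of the two error terms of the objective by t * lam / 4 *)
pose e := lam / (4 * C1); have e0 : 0 < e by rewrite divr_gt0// mulr_gt0.
have he0 : 0 < `|h| + e by rewrite ltr_wpDl.
pose eta := lam / (4 * C2 * (`|h| + e)).
have eta0 : 0 < eta by rewrite divr_gt0// !mulr_gt0.
have /nbhs_ballP[d/= d0 rem] := differentiable_first_order (df0 x) eta0.
have fC : continuous (fun y : 'rV[R]_n.+1 => y - f y).
  move=> y; apply: continuousB; first exact: cvg_id.
  exact: differentiable_continuous.
have [t [t0 ts td [y yt yF]]] : exists t, [/\ 0 < t, t <= f x 0 i - x 0 i,
    t * (`|h| + e) < d &
    exists2 y, `|y - (x + t *: h)| <= e * t & y - f y = x - f x + t *: (h *m (1 - J))].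
  have td : \forall t \near 0^'+, t * (`|h| + e) < d.
    near=> t; rewrite -ltr_pdivlMr//; near: t.
    by apply: nbhs_right_lt; rewrite divr_gt0.
  have sol := local_solve h fC FJ Ju e0.
  near (0 : R)^'+ => t; exists t; split.
  - by near: t; exact: nbhs_right_gt.
  - by near: t; exact: nbhs_right_le.
  - by near: t; exact: td.
  - by near: t; exact: sol.
move: yF; rewrite /h mulmxKV// => yF.
have yj j : y 0 j - f y 0 j = x 0 j - f x 0 j + t * (j == i)%:R.
  by move/rowP/(_ j) : yF; rewrite !mxE eqxx.
have y_feas : feasible f A B y.
  split=> j jAB; have := yj j.
    have [->|ji] := eqVneq j i; first by rewrite mulr1; lra.
    by have := xA j jAB; rewrite mulr0; lra.
  have [ji|ji] := eqVneq j i; first by move: jAB; rewrite BA inE ji iA.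
  by rewrite (xB j jAB) mulr0 => yfy; lra.
have yx : `|y - x| <= t * (`|h| + e).
  have -> : y - x = (y - (x + t *: h)) + t *: h by rewrite opprD addrA subrK.
  rewrite (le_trans (ler_normD _ _))// normrZ gtr0_norm//.
  by rewrite mulrDr addrC lerD2l mulrC.
have yd : ball x d y by rewrite -ball_normE/= distrC (le_lt_trans yx).
have rem_y := rem y yd.
pose phi z := (f0 z *m mu^T) 0 0.
have phiE z : \sum_j mu 0 j * f0 z 0 j = phi z.
  by rewrite /phi mxE; apply: eq_bigr => j _; rewrite mxE mulrC.
have entry (v : 'rV[R]_1) : - `|v| <= v 0 0.
  have /rV_norm_le/(_ 0) := lexx `|v|.
  by rewrite ler_norml => /(_ _)/andP[//|].
have phi_diff : phi y - phi x = t * lam + ((y - (x + t *: h)) *m (G *m mu^T)) 0 0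
    + ((f0 y - f0 x - (y - x) *m G) *m mu^T) 0 0.
  have hy : t *: h + (y - (x + t *: h)) = y - x.
    by rewrite addrC opprD addrA subrK.
  have -> : phi y - phi x = ((f0 y - f0 x) *m mu^T) 0 0.
    by rewrite mulmxBl [RHS]mxE [X in _ = _ + X]mxE.
  have -> : (f0 y - f0 x) *m mu^T = t *: (h *m (G *m mu^T))
      + (y - (x + t *: h)) *m (G *m mu^T)
      + (f0 y - f0 x - (y - x) *m G) *m mu^T.
    rewrite scalemxAl -mulmxDl hy (mulmxA (y - x)) -mulmxDl.
    by rewrite [X in _ = X *m _]addrC subrK.
  by rewrite -hG [LHS]mxE; congr (_ + _); rewrite [LHS]mxE; congr (_ + _); rewrite mxE.
have := entry ((y - (x + t *: h)) *m (G *m mu^T)).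
have := entry ((f0 y - f0 x - (y - x) *m G) *m mu^T).
have b1 : `|(y - (x + t *: h)) *m (G *m mu^T)| <= t * (lam / 4).
  rewrite (le_trans (lip1 _))// (le_trans (ler_wpM2l (ltW C10) yt))//.
  by rewrite /e le_eqVlt; apply/orP; left; apply/eqP; field; rewrite !gt_eqF.
have b2 : `|(f0 y - f0 x - (y - x) *m G) *m mu^T| <= t * (lam / 4).
  rewrite (le_trans (lip2 _))// (le_trans (ler_wpM2l (ltW C20) rem_y))//.
  rewrite (le_trans (ler_wpM2l (ltW C20) (ler_wpM2l (ltW eta0) yx)))//.
  by rewrite /eta le_eqVlt; apply/orP; left; apply/eqP; field; rewrite !gt_eqF.
have := xmax y y_feas; rewrite !phiE -subr_le0 phi_diff.
have : 0 < t * lam by rewrite mulr_gt0.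
by lra.
Unshelve. all: by end_near. Qed.

End optimality.

(** * From weighted sums to Pareto optimality *)

(** Weight 1 on the component j and a small weight e elsewhere isolate that
    component. *)
Lemma weighted_sums_le {R : realType} m (u v : 'rV[R]_m) :
  (forall mu : 'rV[R]_m, ltmx 0 mu ->
    \sum_j mu 0 j * u 0 j <= \sum_j mu 0 j * v 0 j) -> lemx u v.
Proof.
move=> uv i j; rewrite (ord1 i) leNgt; apply/negP => vu {i}.
pose S := \sum_(k | k != j) `|u 0 k - v 0 k|.
have S0 : 0 <= S by rewrite sumr_ge0.
pose gap := u 0 j - v 0 j; have gap0 : 0 < gap by rewrite subr_gt0.
pose e := gap / (2 * (1 + S)).
have e0 : 0 < e by rewrite divr_gt0// mulr_gt0// ltr_pwDl.
pose mu : 'rV[R]_m := \row_k if k == j then 1 else e.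
have := uv mu; rewrite -subr_ge0 -sumrB (bigD1 j)//= !mxE eqxx !mul1r.
have mu0 : ltmx 0 mu by move=> i k; rewrite !mxE; case: ifP.
move=> /(_ mu0).
have : \sum_(k | k != j) (mu 0 k * v 0 k - mu 0 k * u 0 k) <= e * S.
  rewrite mulr_sumr ler_sum// => k kj; rewrite mxE (negbTE kj) -mulrBr.
  by rewrite ler_wpM2l ?(ltW e0)// -opprB (le_trans (ler_norm _))// normrN.
have : e * S <= gap / 2.
  have -> : gap / 2 = e * (1 + S) by rewrite /e; field; rewrite gt_eqF// ltr_pwDl.
  by rewrite ler_wpM2l ?(ltW e0)// lerDr.
by rewrite /gap in gap0 *; lra.
Qed.

Unset Implicit Arguments.

Theorem corollary19 (R : realType) (n m : nat)
  (f0 : 'rV[R]_n.+1 -> 'rV[R]_m.+1) (f : 'rV[R]_n.+1 -> 'rV[R]_n.+1)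
  (A B : {set 'I_n.+1}) (a b : 'rV[R]_n.+1) (X : set 'rV[R]_n.+1)
  (f0_diff : forall x, differentiable f0 x)
  (f_diff : forall i x, differentiable (fun y => f y 0 i : R^o) x)
  (AB_compl : B = ~: A)
  (f_box : f @` box a b `<=` box a b)
  (box_candidates : contains_candidates f0 (feasible f A B) (box a b))
  (gqc : general_qualifying_condition f0 f (box a b))
  (X_fixpoint : exists xs, [/\ X xs, box a b xs & xs = f xs]) :
  fast_lipschitz f0 f (feasible f A B `&` X) (box a b).

Proof.
have df : forall x, differentiable f x.
  by move=> x; apply: differentiable_rV => i; exact: f_diff.
have [N normN gqc_box] := gqc.
have [xs [Xxs box_xs xs_fix]] := X_fixpoint.
have contr z : box a b z -> N ('J f z) < 1 by move=> /gqc_box[].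
have fix_uniq x : box a b x -> x = f x -> x = xs.
  by move=> bx fx; exact: (fixed_point_unique normN df contr bx box_xs).
have max_xs (mu : 'rV[R]_m.+1) x : ltmx 0 mu ->
    maximizers (fun y => \sum_j mu 0 j * f0 y 0 j) (feasible f A B) x -> x = xs.
  move=> mu0 xmax; have [_ /(_ x xmax) bx] := box_candidates mu mu0.
  exact: fix_uniq (maximizer_fixed normN AB_compl f0_diff df (gqc_box x bx) mu0 xmax).
have xs_max (mu : 'rV[R]_m.+1) : ltmx 0 mu ->
    maximizers (fun y => \sum_j mu 0 j * f0 y 0 j) (feasible f A B) xs.
  move=> mu0; have [[x xmax] _] := box_candidates mu mu0.
  by rewrite -(max_xs mu x mu0 xmax).
have dominates y : feasible f A B y -> lemx (f0 y) (f0 xs).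
  move=> yF; apply: weighted_sums_le => mu mu0; exact: (xs_max mu mu0).2.
have only_xs y : feasible f A B y -> lemx (f0 xs) (f0 y) -> y = xs.
  move=> yF le_y; have one0 : ltmx 0 (const_mx 1 : 'rV[R]_m.+1).
    by move=> i j; rewrite !mxE.
  apply: (max_xs _ _ one0); split=> // z zF.
  apply: ler_sum => j _; rewrite ler_wpM2l ?mxE//.
  exact: le_trans (dominates z zF 0 j) (le_y 0 j).
have xs_feas : feasible f A B xs.
  by split=> i _; rewrite -xs_fix.
exists xs; split; split=> //.
- split=> // -[y [[yF _] y_xs le_y]]; exact: y_xs (only_xs y yF le_y).
- move=> x [[xF Xx] xP]; apply/eqP; apply: contraPT xP => xs_x; apply.
  by exists xs; split=> //; [exact/eqP|exact: dominates].
- by move=> x [bx fx]; rewrite (fix_uniq x bx fx).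
Qed.
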